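(* Consider a frequency-flat slow-fading channel with instantaneous SNR $\gamma\ge0$ (a random variable) and average SNR $\gamma_0>0$, and let $P_e(\gamma)$ be the instantaneous symbol error rate. If $P_e(\gamma)$ is convex (respectively, concave) in $\gamma$, and the cumulative distribution function of $\gamma$ is a function of $\gamma/\gamma_0$ only, $$\mathrm{CDF}(\gamma)=F(\gamma/\gamma_0)$$ for a fixed function $F$ not depending on $\gamma_0$, then the average symbol error rate $\overline{P}_e(\gamma_0)=\mathbb{E}[P_e(\gamma)]$ is convex (respectively, concave) in $\gamma_0\in(0,\infty)$.
   Context: $P_e:[0,\infty)\to[0,1]$ is the symbol error rate as a function of the SNR in the non-fading AWGN channel; in a slow-fading channel, the SNR $\gamma$ is random with mean $\gamma_0$, and the average symbol error rate is $\overline{P}_e(\gamma_0)=\int_0^\infty P_e(\gamma)\,d\,\mathrm{CDF}(\gamma)$. *)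

(* Defs.v *)
From HB Require Import structures.
From mathcomp Require Import all_boot all_order all_algebra.
From mathcomp Require Import all_classical all_reals all_analysis.
Import Order.TTheory GRing.Theory Num.Theory.
Import numFieldNormedType.Exports.
Set Implicit Arguments.
Unset Strict Implicit.
Unset Printing Implicit Defensive.
Local Open Scope classical_set_scope.
Local Open Scope ring_scope.

(* Same shape as the library's [convex_function], with the inequality reversed;
   neither requires [D] to be convex. *)
Definition concave_function (R : numFieldType) (E : lmodType R)
    (E' := convex_lmodType E) (D : set E') (f : E' -> R^o) :=
  forall t : {i01 R},
    {in D &, forall x y : E', conv t (f x) (f y) <= f (conv t x y)}.

(* The law of the SNR varies with the average SNR [g0], so both the probability
   measure and the random variable are indexed by [g0].  Since [Pe] is only
   meaningful on [0, +oo[, this is the average error rate only when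
   [snr g0 >= 0]; taking [fine] loses nothing when moreover [Pe] is measurable
   with values in [0, 1] there, the expectation then being finite. *)
Definition average_error_rate (d : measure_display) (T : measurableType d)
    (R : realType) (P : R -> probability T R)
    (snr : forall g0 : R, {RV (P g0) >-> R}) (Pe : R -> R) (g0 : R) : R :=
  fine ('E_(P g0)[Pe \o snr g0])%E.

(* Main.v *)
Require Import Defs.
From mathcomp Require Import all_boot all_order all_algebra.
From mathcomp Require Import all_classical all_reals all_analysis.
From mathcomp Require Import measurable_realfun ring lra.
Import Order.TTheory GRing.Theory Num.Theory.
Import numFieldNormedType.Exports.
Local Open Scope classical_set_scope.
Local Open Scope ring_scope.

(* The law of the SNR at level g is that of g * snr 1, since both have the same
   CDF; hence the average error rate at g is the integral of Pe (g * snr 1)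
   against the single measure P 1, an average of functions of g that are convex
   (concave) together with Pe.  Measurability of Pe comes for free: a convex
   (concave) function on [0, +oo[ with values in [0, 1] is monotone. *)

Lemma conv_subE (R : numDomainType) (a b : R^o) (t : {i01 R}) :
  conv t a b = t%:num * a + (1 - t%:num) * b.
Proof. by []. Qed.

(** A strict drop from [x] to [y] would, by concavity, go on at least linearly beyond [y] and
    eventually push [f] below 0. *)
Lemma concave_ge0_nondecreasing (R : realType) (f : R -> R) :
  (forall x, 0 <= x -> 0 <= f x) ->
  concave_function (`[0, +oo[%classic : set R) f ->
  forall x y, 0 <= x -> x <= y -> f x <= f y.
Proof.
move=> f0 cf x y x0 xy; rewrite leNgt; apply/negP => fyx.
have fy0 : 0 <= f y by rewrite f0// (le_trans x0).
have fx0 : 0 < f x by exact: le_lt_trans fyx.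
(* This weight makes [(1 - t) * f x] the midpoint of [f x] and [f y]. The point [z] is then placed
   so that [y] is the combination of [z] and [x] with weight [t]; as [f z >= 0], concavity puts
   [f y] above that midpoint, contradicting [f y < f x]. *)
pose t := (f x - f y) / (2 * f x).
have t0 : 0 < t by rewrite divr_gt0 ?subr_gt0 ?mulr_gt0.
have tfx : t * f x = (f x - f y) / 2 by rewrite /t; field; rewrite gt_eqF.
have t1 : t <= 1 by rewrite /t ler_pdivrMr ?mulr_gt0//; lra.
pose z := x + (y - x) / t.
have z0 : 0 <= z by rewrite addr_ge0// divr_ge0 ?subr_ge0// ltW.
have cfzx : t * f z + (1 - t) * f x <= f (t * z + (1 - t) * x).
  by apply: (cf (Itv01 (ltW t0) t1) z x); rewrite inE /= in_itv/= ?z0 ?x0.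
have zxy : t * z + (1 - t) * x = y by rewrite /z; field; rewrite gt_eqF.
rewrite zxy in cfzx.
have := mulr_ge0 (ltW t0) (f0 z z0).
lra.
Qed.

Lemma concave_onem (R : realType) (D : set R) (f : R -> R) :
  convex_function D f -> concave_function D (fun x => 1 - f x).
Proof.
move=> cf t x y Dx Dy; have := cf t x y Dx Dy.
by rewrite !conv_subE; lra.
Qed.

(** Passing to [1 - f] turns convexity into concavity and the upper bound 1 into the lower bound 0,
    which reduces to the concave case. *)
Lemma convex_le1_nonincreasing (R : realType) (f : R -> R) :
  (forall x, 0 <= x -> f x <= 1) ->
  convex_function (`[0, +oo[%classic : set R) f ->
  forall x y, 0 <= x -> x <= y -> f y <= f x.
Proof.
move=> f1 /concave_onem cf x y x0 xy.
suff : 1 - f x <= 1 - f y by lra.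
apply: (@concave_ge0_nondecreasing _ (fun x => 1 - f x)) => // u u0.
by rewrite subr_ge0 f1.
Qed.

(** The intervals []a, b]] are stable under intersection and generate the Borel sets, and the CDF
    determines their measure; the []-n, n]] exhaust the line with finite measure. *)
Lemma cdf_inj d1 d2 (T1 : measurableType d1) (T2 : measurableType d2)
    (R : realType) (P1 : probability T1 R) (P2 : probability T2 R)
    (X1 : {RV P1 >-> R}) (X2 : {RV P2 >-> R}) :
  cdf X1 =1 cdf X2 ->
  forall A : set R, measurable A -> distribution P1 X1 A = distribution P2 X2 A.
Proof.
move=> X12.
apply: (@measure_unique _ R _ (@ocitv R) (fun n => `]-(n%:R), n%:R]%classic)).
- by [].
- exact: ocitvI.
- by move=> i; exact: is_ocitv.
- rewrite -subTset => x _ /=.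
  (* The successor gives a strict bound on [|x|], as the open left endpoint requires. *)
  exists (Num.truncn `|x|).+1 => //=.
  have xn : `|x| < (Num.truncn `|x|).+1%:R by rewrite truncnS_gt.
  by move: xn; rewrite in_itv/= ltr_norml => /andP[-> /ltW].
- move=> _ [[a b] _ <-] /=.
  have [ab|ba] := leP a b; last first.
    by rewrite set_itv_ge ?measure0// bnd_simp -leNgt ltW.
  (* As a difference of two rays, the interval has measure the difference of two CDF values. *)
  have -> : `]a, b]%classic = `]-oo, b] `\` `]-oo, a].
    by rewrite -[RHS]setCK setCD setCitvl setUC -[LHS]setCK setCitv.
  have aEb : `]-oo, b] `&` `]-oo, a] = `]-oo, a]%classic :> set R.
    by rewrite setIidr//; exact: subset_itvl.
  rewrite !measureD//= ?aEb; first last.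
  + by rewrite ltey_eq fin_num_measure.
  + by rewrite ltey_eq fin_num_measure.
  by have := X12 a; have := X12 b; rewrite /cdf => -> ->.
- by move=> k; rewrite ltey_eq fin_num_measure.
Qed.

(** Settles the negative half-line, where [snr_cdf] says nothing. *)
Lemma cdf_lt0 d (T : measurableType d) (R : realType) (P : probability T R)
    (X : {RV P >-> R}) (x : R) :
  (forall w, 0 <= X w) -> x < 0 -> cdf X x = 0%E.
Proof.
move=> X0 x0; rewrite /cdf /distribution /pushforward.
rewrite [X in P X](_ : _ = set0) ?measure0//.
rewrite -subset0 => w /=; rewrite in_itv/= => Xx.
by have := X0 w; rewrite leNgt (le_lt_trans Xx x0).
Qed.

Lemma cdf_scale d (T : measurableType d) (R : realType) (P : probability T R)
    (X : {RV P >-> R}) (g x : R) : 0 < g ->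
  cdf (g *: X : {RV P >-> R}) x = cdf X (x / g).
Proof.
move=> g0; rewrite /cdf /distribution /pushforward; congr (P _).
by apply/seteqP; split => w /=; rewrite !in_itv/= ler_pdivlMr// mulrC.
Qed.

Lemma probability_integrable_itv01 d (T : measurableType d) (R : realType)
    (P : probability T R) (f : T -> R) :
  measurable_fun setT f -> (forall w, 0 <= f w <= 1) ->
  P.-integrable setT (EFin \o f).
Proof.
move=> mf f01; apply: measurable_bounded_integrable => //.
  by rewrite ltey_eq fin_num_measure.
exists 1; split; first exact: num_real.
move=> M M1 w _ /=; have /andP[f0 f1] := f01 w.
by rewrite ger0_norm// (le_trans f1)// ltW.
Qed.

Section scale_family.
Context {R : realType} {d : measure_display} {T : measurableType d}.
Variables (P : R -> probability T R) (snr : forall g0 : R, {RV (P g0) >-> R}).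
Variables (Pe F : R -> R).
Hypothesis Pe01 : forall x : R, 0 <= x -> 0 <= Pe x <= 1.
Hypothesis snr_ge0 : forall (g0 : R) (w : T), 0 < g0 -> 0 <= snr g0 w.
Hypothesis snr_cdf : forall g0 x : R, 0 < g0 -> 0 <= x ->
  cdf (snr g0) x = (F (x / g0))%:E.

(** For [x >= 0] both sides equal [F (x / g)], by [snr_cdf] at levels [g] and 1; for [x < 0] both
    vanish. *)
Let cdf_scale_family (g : R) : 0 < g ->
  cdf (snr g) =1 cdf (g *: snr 1 : {RV (P 1) >-> R}).
Proof.
move=> g0 x; rewrite cdf_scale//; have [x0|x0] := leP 0 x.
  have xg0 : 0 <= x / g by rewrite divr_ge0// ltW.
  by rewrite !snr_cdf// divr1.
have xg0 : x / g < 0 by rewrite pmulr_llt0 ?invr_gt0.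
by rewrite !cdf_lt0// => w; exact: snr_ge0.
Qed.

(* [Pe] is arbitrary on negative reals, hence the clipping. *)
Let Q (x : R) := Pe (Num.max x 0).

Let Q01 (x : R) : 0 <= Q x <= 1.
Proof. by rewrite /Q Pe01// le_max lexx orbT. Qed.

Let QE (x : R) : 0 <= x -> Q x = Pe x.
Proof. by move=> x0; rewrite /Q max_l. Qed.

(** Left as a hypothesis here because it will come from monotonicity, whose direction differs
    between the convex and the concave case. *)
Hypothesis mQ : measurable_fun setT Q.

Let integrable_scale (g : R) : 0 < g ->
  (P 1).-integrable setT (EFin \o (fun w => Pe (g * snr 1 w))).
Proof.
move=> g0; have s0 w : 0 <= g * snr 1 w by rewrite mulr_ge0 ?snr_ge0// ltW.
apply: probability_integrable_itv01 => [|w]; last exact: Pe01.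
rewrite (_ : (fun w => _) = Q \o (g *: snr 1 : {RV (P 1) >-> R})).
  by apply: (measurableT_comp mQ).
by apply/funext => w /=; rewrite QE ?s0.
Qed.

(** Change of variables, twice: push the integral forward to the law of [snr g], identify that law
    with the one of [g *: snr 1], and pull back to [P 1]. *)
Let average_error_rateE (g : R) : 0 < g ->
  average_error_rate snr Pe g = \int[P 1]_w Pe (g * snr 1 w).
Proof.
move=> g0; rewrite /average_error_rate /Rintegral unlock; congr fine.
(* The change of variables is applied to an integrand measurable and nonnegative on the whole line,
   hence [Q] in place of [Pe]. *)
transitivity (\int[P g]_w (EFin \o Q \o snr g) w)%E.
  by apply: eq_integral => w _ /=; rewrite QE// snr_ge0.
have /measurable_EFinP mEQ := mQ.
have EQ0 y : (0 <= (EFin \o Q) y)%E by rewrite lee_fin; case/andP: (Q01 y).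
rewrite -ge0_integral_distribution//.
rewrite (eq_measure_integral
  (distribution (P 1) (g *: snr 1 : {RV (P 1) >-> R}))).
  rewrite ge0_integral_distribution//; apply: eq_integral => w _ /=.
  by rewrite QE// mulr_ge0 ?snr_ge0// ltW.
by move=> A mA _; apply: cdf_inj => //; exact: cdf_scale_family.
Qed.

Let integrable_mul_scale (a g : R) : 0 < g ->
  (P 1).-integrable setT (EFin \o (fun w => a * Pe (g * snr 1 w))).
Proof.
move=> g0; exact: (integrableZl measurableT a (integrable_scale g g0)).
Qed.

Let integrable_conv (a b x y : R) : 0 < x -> 0 < y ->
  (P 1).-integrable setT
    (EFin \o (fun w => a * Pe (x * snr 1 w) + b * Pe (y * snr 1 w))).
Proof.
move=> x0 y0; exact: (integrableD measurableT
  (integrable_mul_scale a x x0) (integrable_mul_scale b y y0)).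
Qed.

Let conv_average_error_rate (t : {i01 R}) (x y : R) : 0 < x -> 0 < y ->
  conv t (average_error_rate snr Pe x : R^o) (average_error_rate snr Pe y) =
  \int[P 1]_w (t%:num * Pe (x * snr 1 w) + (1 - t%:num) * Pe (y * snr 1 w)).
Proof.
move=> x0 y0; rewrite conv_subE !average_error_rateE//.
rewrite RintegralD//; [|exact: integrable_mul_scale..].
by rewrite !RintegralZl//; exact: integrable_scale.
Qed.

(** Linearity of scaling at a fixed outcome [w] is what transfers the convexity or concavity of [Pe]
    to the integrand as a function of the average SNR. *)
Let scale_conv (t : {i01 R}) (x y : R) w :
  conv t (x : R^o) y * snr 1 w = conv t (x * snr 1 w : R^o) (y * snr 1 w).
Proof. by rewrite !conv_subE; ring. Qed.

Let scale_in_domain (g : R) w : 0 < g ->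
  g * snr 1 w \in (`[0, +oo[%classic : set R).
Proof.
by move=> g0; rewrite inE/= in_itv/= andbT mulr_ge0 ?snr_ge0// ltW.
Qed.

Lemma convex_average_error_rate :
  convex_function (`[0, +oo[%classic : set R) Pe ->
  convex_function (`]0, +oo[%classic : set R) (average_error_rate snr Pe).
Proof.
move=> cPe t x y; rewrite !inE/= !in_itv/= !andbT => x0 y0.
have xy0 : 0 < conv t (x : R^o) y by exact: convR_gt0.
rewrite conv_average_error_rate// average_error_rateE//.
apply: le_Rintegral => //; [exact: integrable_scale|exact: integrable_conv|].
move=> w _; rewrite scale_conv.
exact: (cPe t _ _ (scale_in_domain x w x0) (scale_in_domain y w y0)).
Qed.

Lemma concave_average_error_rate :
  concave_function (`[0, +oo[%classic : set R) Pe ->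
  concave_function (`]0, +oo[%classic : set R) (average_error_rate snr Pe).
Proof.
move=> cPe t x y; rewrite !inE/= !in_itv/= !andbT => x0 y0.
have xy0 : 0 < conv t (x : R^o) y by exact: convR_gt0.
rewrite conv_average_error_rate// average_error_rateE//.
apply: le_Rintegral => //; [exact: integrable_conv|exact: integrable_scale|].
move=> w _; rewrite scale_conv.
exact: (cPe t _ _ (scale_in_domain x w x0) (scale_in_domain y w y0)).
Qed.

End scale_family.

Theorem theorem10 (R : realType) (d : measure_display) (T : measurableType d)
    (P : R -> probability T R)
    (snr : forall g0 : R, {RV (P g0) >-> R})
    (Pe F : R -> R)
    (Pe01 : forall x : R, 0 <= x -> 0 <= Pe x <= 1)
    (snr_ge0 : forall (g0 : R) (w : T), 0 < g0 -> 0 <= snr g0 w)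
    (snr_mean : forall g0 : R, 0 < g0 -> ('E_(P g0)[snr g0] = g0%:E)%E)
    (snr_cdf : forall g0 x : R, 0 < g0 -> 0 <= x ->
       cdf (snr g0) x = (F (x / g0))%:E) :
  (convex_function (`[0, +oo[%classic : set R) Pe ->
   convex_function (`]0, +oo[%classic : set R)
     (average_error_rate snr Pe)) /\
  (concave_function (`[0, +oo[%classic : set R) Pe ->
   concave_function (`]0, +oo[%classic : set R)
     (average_error_rate snr Pe)).
Proof.
have Pe_ge0 x : 0 <= x -> 0 <= Pe x by move=> /Pe01 /andP[].
have Pe_le1 x : 0 <= x -> Pe x <= 1 by move=> /Pe01 /andP[].
(* Clipping is monotone with values in [[0, +oo[], so the clipped [Pe] is monotone on the whole
   line, hence measurable. *)
have max_le (u v : R) : u <= v -> Num.max u 0 <= Num.max v 0.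
  by move=> uv; rewrite ge_max !le_max uv lexx !orbT.
have max_ge0 (u : R) : 0 <= Num.max u 0 by rewrite le_max lexx orbT.
split=> cPe.
- apply: convex_average_error_rate Pe01 snr_ge0 snr_cdf _ (cPe).
  apply: nonincreasing_measurable => // u v uv.
  exact: (convex_le1_nonincreasing _ Pe Pe_le1 cPe _ _
    (max_ge0 u) (max_le u v uv)).
- apply: concave_average_error_rate Pe01 snr_ge0 snr_cdf _ (cPe).
  apply: nondecreasing_measurable => // u v uv.
  exact: (concave_ge0_nondecreasing _ Pe Pe_ge0 cPe _ _
    (max_ge0 u) (max_le u v uv)).
Qed.
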